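(* Let $(\mathbf V,S^* )$ be a monotone sampling scheme and let $f:\mathbf V\to[0,\infty)$. Let $\prec$ be the partial order on $\mathbf V$ given by $v\prec v'\iff f(v)<f(v')$. Then a $\prec^+$-optimal estimator for $f$ with respect to this partial order must be equivalent to the L* estimator $\hat f^{(L)}$.
   Context: A monotone sampling scheme consists of a set $\mathbf V$ (the data domain) and a map assigning to each seed $u\in(0,1]$ and data vector $v\in\mathbf V$ a set $S^*(u,v)\subseteq\mathbf V$ with $v\in S^*(u,v)$, such that for each fixed $v$ the set $S^*(u,v)$ is non-decreasing (under inclusion) in $u$. The outcome (sample) $S(u,v)$ of data $v$ with seed $u$ includes the seed $u$, and $S^*(u,v)$ is the set of all data vectors consistent with the outcome: $z\in S^*(u,v)$ implies $S(u,z)=S(u,v)$ and $S^*(u,z)=S^*(u,v)$. Standing assumption: if $z\in S^*(\rho,v)$ then there is $\epsilon>0$ such that $z\in S^*(x,v)$ for all $x\in(\rho-\epsilon,1]\cap(0,1]$. An estimator $\hat f$ is a real-valued function of the outcome; write $\hat f(u,v)=\hat f(S(u,v))$ (so $\hat f(u,z)=\hat f(u,v)$ whenever $z\in S^*(u,v)$); it is assumed Lebesgue integrable in $u\in(0,1]$ for each $v$. The seed is uniform on $[0,1]$. $\hat f$ is nonnegative if $\hat f(u,v)\ge0$ for all $u,v$, and unbiased if $\int_0^1\hat f(u,v)\,du=f(v)$ for all $v$; its variance on $v$ is then $\int_0^1\hat f(u,v)^2du-f(v)^2$. Two estimators are equivalent if for every $v$ they agree for almost every $u\in(0,1]$. For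 a partial order $\prec$ on $\mathbf V$, a nonnegative unbiased estimator $\hat f$ is $\prec^+$-optimal if there is no other nonnegative unbiased estimator with strictly lower variance on some data $v$ and at most the variance of $\hat f$ on all vectors that precede $v$. Lower bound function: $\underline f^{(v)}(u)=\inf\{f(z): z\in S^*(u,v)\}$ for $u\in(0,1]$. The L* estimator is the solution $\hat f^{(L)}$ of $\hat f^{(L)}(\rho,v)=\frac1\rho\big(\underline f^{(v)}(\rho)-\int_\rho^1\hat f^{(L)}(u,v)\,du\big)$ for all $v\in\mathbf V$, $\rho\in(0,1]$.
   Formalization: The formal theorem additionally assumes that the optimal estimator has finite variance on every data vector; if infinite variances are allowed, there are schemes where every nonnegative unbiased estimator is vacuously optimal and the claim fails. *)

(* Defs.v *)
From mathcomp Require Import all_boot all_order all_algebra.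
From mathcomp Require Import all_classical all_reals all_analysis.

Set Implicit Arguments.
Unset Strict Implicit.
Unset Printing Implicit Defensive.
Import Order.TTheory GRing.Theory Num.Theory.
Import numFieldNormedType.Exports.
Local Open Scope classical_set_scope.
Local Open Scope ring_scope.

(* [S u v] is the set S^*(u,v) of data consistent with the outcome of data v
   under seed u.  As the outcome includes the seed and S^*(u,v) is exactly the
   set of data producing it, the outcome is identified with (u, S^*(u,v)).
   Values of [S] at seeds outside ]0, 1] are irrelevant. *)
Record monotone_sampling (R : realType) (V : Type) (S : R -> V -> set V)
    : Prop := MonotoneSampling {
  sampling_refl : forall (u : R) (v : V), 0 < u <= 1 -> S u v v ;
  sampling_mono : forall (u u' : R) (v : V),
    0 < u <= 1 -> 0 < u' <= 1 -> u <= u' -> S u v `<=` S u' v ;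
  sampling_consistent : forall (u : R) (v z : V),
    0 < u <= 1 -> S u v z -> S u z = S u v ;
  sampling_open : forall (rho : R) (v z : V), 0 < rho <= 1 -> S rho v z ->
    exists2 e : R, 0 < e &
      forall x : R, rho - e < x -> 0 < x <= 1 -> S x v z }.

Section Estimators.
Context (R : realType) (V : Type).
Implicit Types (S : R -> V -> set V) (f : V -> R) (g h : R -> V -> R).

Local Notation mu := (@lebesgue_measure R).

(* The invariance clause says that [g u v] is a function of the outcome. *)
Definition estimator S g : Prop :=
  (forall (u : R) (v z : V), 0 < u <= 1 -> S u v z -> g u z = g u v) /\
  (forall v : V, mu.-integrable `]0, 1] (fun u => (g u v)%:E)).

Definition nonnegative g : Prop :=
  forall (u : R) (v : V), 0 < u <= 1 -> 0 <= g u v.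

Definition unbiased f g : Prop :=
  forall v : V, \int[mu]_(u in `]0, 1]) g u v = f v.

Definition nonneg_unbiased S f g : Prop :=
  [/\ estimator S g, nonnegative g & unbiased f g].

(* Extended-real valued: +oo when [g ^~ v] is not square integrable. *)
Definition variance f g (v : V) : \bar R :=
  (\int[mu]_(u in `]0%R, 1%R]) ((g u v) ^+ 2)%:E - ((f v) ^+ 2)%:E)%E.

(* On data where every nonnegative unbiased estimator has infinite variance,
   the order below compares nothing, and optimality there would be vacuous. *)
Definition finite_variance f g : Prop :=
  forall v : V, (variance f g v < +oo)%E.

Definition equivalent g h : Prop :=
  forall v : V, {ae mu, forall u, 0 < u <= 1 -> g u v = h u v}.

(* A competitor is automatically different from [g], since one of its
   variances is strictly smaller. *)
Definition prec_plus_optimal S f (prec : V -> V -> Prop) g : Prop :=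
  nonneg_unbiased S f g /\
  ~ (exists h, nonneg_unbiased S f h /\
       exists v : V, (variance f h v < variance f g v)%E /\
         forall z : V, prec z v -> (variance f h z <= variance f g z)%E).

Definition lower_bound S f (v : V) (u : R) : R := inf [set f z | z in S u v].

(* Integrability on [rho, 1] makes the integral in the equation meaningful;
   the Lebesgue integral of a non-integrable function is a junk value. *)
Definition is_Lstar S f g : Prop :=
  forall (v : V) (rho : R), 0 < rho <= 1 ->
    mu.-integrable `[rho, 1] (fun u => (g u v)%:E) /\
    g rho v =
      rho^-1 * (lower_bound S f v rho - \int[mu]_(u in `[rho, 1]) g u v).

End Estimators.

(* Main.v *)
(* Seeds are explored downwards from 1.  For data v and a seed r, put
   M = int_r^1 fhat(u,v) du and phi = (lb(r) - M) / r; the L* equation says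
   fhat(r,v) = phi.  Every z in S(r,v) agrees with v on ]r, 1], so its estimates
   below r average (f z - M) / r >= phi.

   Given a slope c, let E_z(x) = int_x^r (fhat(u,z) - c) du be the excess over
   the constant c.  The competitor replaces fhat by c on ]T, r[, where T is a
   stopping time, so that it is still a function of the outcome, and spreads the
   excess E_z(T) >= 0 uniformly over ]0, T[.  Where E_z(T) = 0 the replacement
   is an averaging, which by Jensen does not increase the second moment.
   - If fhat(r,v) < phi, take c = phi and stop when E_z returns to 0, which must
     happen by seed 0 at the latest: no variance increases, that of v drops.
   - If fhat(r,v) > phi, choose z0 in S(r,v) with f z0 close to lb(r), take
     c = (f z0 - M) / r and stop when E_z returns to 0 or when the outcome
     reveals f z > f z0: the variance of z0 drops, and those of data
     preceding z0 do not increase.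
   As fhat(.,v) is almost everywhere the derivative of its integral, this
   gives the L* equation for almost all seeds, and its solution is unique
   because it is a linear Volterra equation on each [x, 1], x > 0. *)
Require Import Defs.
From mathcomp Require Import all_boot all_order all_algebra.
From mathcomp Require Import all_classical all_reals all_analysis.
From mathcomp Require Import measurable_realfun ring lra.
Import Order.TTheory GRing.Theory Num.Theory.
Import numFieldNormedType.Exports.
Local Open Scope classical_set_scope.
Local Open Scope ring_scope.

Set Implicit Arguments.
Unset Strict Implicit.
Unset Printing Implicit Defensive.

Local Notation mu := lebesgue_measure.
Local Notation intble a b g := (mu.-integrable `]a, b] (EFin \o g)).
Local Notation itg a b g := (\int[mu]_(u in `]a, b]) g u).

(** * Integration over half-open intervals, Jensen's inequality, Lebesgue differentiation *)

Section IntervalIntegrals.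
Context {R : realType}.
Implicit Types (a b c d k e x y : R) (g h : R -> R).

Lemma intble_sub a b c d g : a <= b -> c <= d -> intble a d g -> intble b c g.
Proof.
move=> ab cd; apply: integrableS => //.
by apply: subset_itv; rewrite bnd_simp.
Qed.

Lemma intble_cst a b k : intble a b (fun=> k).
Proof.
apply: measurable_bounded_integrable => //.
- by rewrite /= lebesgue_measure_itv/=; case: ifPn => // _; rewrite -EFinB ltry.
- exact: (@bounded_cst _ R^o).
Qed.

Lemma intbleD a b g h : intble a b g -> intble a b h ->
  intble a b (fun u => g u + h u).
Proof.
by move=> ig ih; exact: (@integrableD _ _ _ mu _ (measurable_itv _) _ _ ig ih). Qed.

Lemma intbleZ a b k g : intble a b g -> intble a b (fun u => k * g u).
Proof.
by move=> ig; exact: (@integrableZl _ _ _ mu _ (measurable_itv _) k _ ig). Qed.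

Lemma intbleB a b g h : intble a b g -> intble a b h ->
  intble a b (fun u => g u - h u).
Proof.
by move=> ig ih; exact: (@integrableB _ _ _ mu _ (measurable_itv _) _ _ ig ih). Qed.

Lemma itg_xx a g : itg a a g = 0.
Proof. by rewrite set_itvoc0 ?Rintegral_set0. Qed.

Lemma itg_cat b a c g : a <= b -> b <= c -> intble a c g ->
  itg a c g = itg a b g + itg b c g.
Proof.
move=> ab bc ig.
rewrite -(@Rintegral_itvB _ _ (BRight a) (BRight c) b ig) ?bnd_simp//.
by rewrite addrC subrK.
Qed.

Lemma itg_cst a b k : a <= b -> itg a b (fun=> k) = k * (b - a).
Proof.
move=> ab; rewrite Rintegral_cst//= lebesgue_measure_itv/= lte_fin.
case: ltP => //= ba; have -> : a = b by apply/eqP; rewrite eq_le ab.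
by rewrite subrr.
Qed.

Lemma itgD a b g h : intble a b g -> intble a b h ->
  itg a b (fun u => g u + h u) = itg a b g + itg a b h.
Proof. exact: RintegralD. Qed.

Lemma itgB a b g h : intble a b g -> intble a b h ->
  itg a b (fun u => g u - h u) = itg a b g - itg a b h.
Proof. exact: RintegralB. Qed.

Lemma itgZ a b k g : intble a b g ->
  itg a b (fun u => k * g u) = k * itg a b g.
Proof. exact: RintegralZl. Qed.

Lemma itgBcst a b k g : a <= b -> intble a b g ->
  itg a b (fun u => g u - k) = itg a b g - k * (b - a).
Proof. by move=> ab ig; rewrite itgB ?itg_cst//; exact: intble_cst. Qed.

(** The endpoint [b] is a null set. This frees the breakpoints of piecewise functions from any
    constraint. *)
Lemma intble_eq_oo a b g h : {in `]a, b[, g =1 h} -> intble a b g ->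
  intble a b h.
Proof.
move=> gh /integrableP[/measurable_EFinP mg ig].
have mh : measurable_fun `]a, b] h.
  apply/measurable_fun_itv_bndo_bndcP.
  move/measurable_fun_itv_bndo_bndcP : mg; apply: eq_measurable_fun => x.
  by rewrite inE => xab; rewrite gh.
apply/integrableP; split; first exact/measurable_EFinP.
rewrite (le_lt_trans _ ig)// le_eqVlt; apply/orP; left; apply/eqP.
apply: (@eq_integral_itv_bounded _ a b (fun x => `|g x|) (fun x => `|h x|)).
- apply: measurableT_comp => //.
  by apply: measurable_funS mh => //; apply: subset_itv; rewrite bnd_simp.
- apply: measurableT_comp => //.
  by apply: measurable_funS mg => //; apply: subset_itv; rewrite bnd_simp.
- by move=> x xab; rewrite gh.
Qed.

Lemma itg_eq_oo a b g h : {in `]a, b[, g =1 h} -> intble a b g ->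
  itg a b g = itg a b h.
Proof.
move=> gh ig; have ih := intble_eq_oo gh ig.
rewrite /Rintegral; congr fine; apply: eq_integral_itv_bounded => //.
- have /integrableP[/measurable_EFinP + _] := ig.
  by apply: measurable_funS => //; apply: subset_itv; rewrite bnd_simp.
- have /integrableP[/measurable_EFinP + _] := ih.
  by apply: measurable_funS => //; apply: subset_itv; rewrite bnd_simp.
Qed.

Lemma intble_cat b a c g : a <= b -> b <= c -> intble a b g -> intble b c g ->
  intble a c g.
Proof.
move=> ab bc /integrableP[/measurable_EFinP m1 i1].
move=> /integrableP[/measurable_EFinP m2 i2].
have E : `]a, c]%classic = `]a, b] `|` `]b, c].
  by rewrite -itv_bndbnd_setU ?bnd_simp.
have m : measurable_fun `]a, c] g by rewrite E; apply/measurable_funU.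
apply/integrableP; split; first exact/measurable_EFinP.
rewrite E ge0_integral_setU//=.
- exact: lte_add_pinfty.
- by rewrite -E; apply/measurable_EFinP/measurableT_comp.
- apply/disj_set2P; rewrite -subset0 => z/=; rewrite !in_itv/= => -[/andP[_]].
  by rewrite leNgt => /negbTE ->.
Qed.

(** Absolute continuity of the integral, obtained from the extension of [g] by 0 to the whole
    line. *)
Lemma intble_abs_cont a b g e : 0 < e -> intble a b g ->
  exists2 d, 0 < d & forall x y, a <= x -> x <= y -> y <= b -> y - x < d ->
    `|itg x y g| < e.
Proof.
move=> e0 ig.
have ig' : mu.-integrable setT (EFin \o (g \_ `]a, b])).
  by rewrite -restrict_EFin; apply/integrable_restrict => //=; rewrite setTI.
have [d [d0 H]] := integral_normr_continuous ig' e0.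
exists d => // x y ax xy yb yxd.
have S : `]x, y] `<=` `]a, b] by apply: subset_itv; rewrite bnd_simp.
apply: le_lt_trans (H `]x, y]%classic _ _); [|by []|].
  apply: le_trans (le_normr_Rintegral _ _) _ => //.
    exact: (intble_sub ax yb).
  rewrite le_eqVlt; apply/orP; left; apply/eqP; apply: eq_Rintegral => z.
  by rewrite inE => zxy; rewrite patchE mem_set//; exact: S.
by rewrite /= lebesgue_measure_itv/= lte_fin; case: ifPn => // _; rewrite -EFinD lte_fin.
Qed.

(** For [a < b], expand the integral of [(g u - m) ^+ 2], which is nonnegative, at the mean [m] of
    [g]. *)
Lemma itg_jensen a b g : a <= b -> intble a b g ->
  intble a b (fun u => g u ^+ 2) ->
  itg a b g ^+ 2 <= (b - a) * itg a b (fun u => g u ^+ 2).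
Proof.
rewrite le_eqVlt => /predU1P[->|ab] ig ig2.
  by rewrite !itg_xx mulr0 expr0n.
have ba : 0 < b - a by rewrite subr_gt0.
set J := itg a b g; set m := J / (b - a).
have : 0 <= itg a b (fun u => (g u - m) ^+ 2).
  by apply: Rintegral_ge0 => x _; exact: sqr_ge0.
have -> : (fun u => (g u - m) ^+ 2) =
    (fun u => (g u ^+ 2 + (- (m *+ 2)) * g u) + m ^+ 2).
  by apply/funext => u; ring.
have ic := intble_cst a b (m ^+ 2).
have iz := intbleZ (- (m *+ 2)) ig.
rewrite itgD//; last exact: intbleD.
rewrite itgD// itgZ// itg_cst ?(ltW ab)// -/J.
set Q := (\int[mu]_(u in _) _)%R.
have -> : Q + - (m *+ 2) * J + m ^+ 2 * (b - a) = ((b - a) * Q - J ^+ 2) / (b - a).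
  by rewrite /m; field; rewrite gt_eqF.
by rewrite pmulr_lge0 ?invr_gt0// subr_ge0.
Qed.

Lemma itg_ae_bound a b g k : 0 <= k -> a <= b -> intble a b g ->
  {ae mu, forall x, a < x < b -> `|g x| <= k} -> `|itg a b g| <= k * (b - a).
Proof.
move=> k0 ab ig gk.
have [mg _] := integrableP _ _ _ ig.
apply: le_trans (le_normr_Rintegral _ ig) _ => //.
have ign : intble a b (fun x => `|g x|) by exact: integrable_norm.
rewrite -lee_fin /Rintegral fineK; last exact: integrable_fin_num.
have := @integral_le_bound _ _ _ mu `]a, b]%classic (EFin \o g) k%:E (measurable_itv _) mg.
rewrite /= lebesgue_measure_itv/= lte_fin.
have -> : (if a < b then (b%:E - a%:E)%E else 0%E) = (b - a)%:E.
  case: ltP => // ba; have -> : a = b by apply/eqP; rewrite eq_le ab.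
  by rewrite subrr.
apply; first by [].
(* The bound is assumed on the open interval only, so the endpoint [b] is discarded as a null
   set. *)
have nb : {ae mu, forall x, x <> b}.
  exists [set b]; split => //; first exact: lebesgue_measure_set1.
  by move=> x /= /contrapT.
apply: (@filterS2 _ _ (ae_filter_ringOfSetsType mu) _ _ _ _ gk nb) => x + xb.
rewrite in_itv/= => H /andP[ax]; rewrite le_eqVlt => /predU1P[//|xlb].
by rewrite lee_fin H// ax.
Qed.

(** Lebesgue differentiation of the primitive of [g] extended by 0. Only left increments are kept,
    since a competitor departs from the estimator at seeds below [r]. *)
Lemma ae_left_density g : intble 0 1 g ->
  {ae mu, forall x, 0 < x < 1 -> forall e, 0 < e ->
    exists2 d, 0 < d & forall y, 0 < y -> x - d < y -> y < x ->
      `|itg y x g - g x * (x - y)| <= e * (x - y)}.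
Proof.
move=> ig.
pose G := g \_ `]0, 1].
have iG : mu.-integrable setT (EFin \o G).
  by rewrite -restrict_EFin; apply/integrable_restrict => //=; rewrite setTI.
have iGy y : mu.-integrable `]-oo, y] (EFin \o G) by exact: integrableS iG.
have locG : locally_integrable setT G by apply: integrable_locally.
have := FTC1Ny iGy locG.
apply: (@filterS _ _ (ae_filter_ringOfSetsType mu)) => x /= [Fd Fx] /andP[x0 x1] e e0.
move: Fd; rewrite /derivable => /cvg_ex[l Fl].
have lE : l = g x.
  move/cvg_lim: (Fl) => /(_ (@Rhausdorff R)); rewrite -/(derive _ _ _) -derive1E Fx.
  by move=> <-; rewrite /G patchE mem_set//= in_itv/= x0 ltW.
rewrite {}lE in Fl.
move/cvgrPdist_le : Fl => /(_ _ e0) [d /= d0 Hd].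
exists d => // y y0 xdy yx.
have /Hd : ball_ (fun x : R => `|x|) 0 d (y - x).
  by rewrite /ball_/= sub0r opprB gtr0_norm ?subr_gt0// ltrBlDl -ltrBlDr.
have yx0 : y - x != 0 by rewrite subr_eq0 lt_eqF.
move/(_ yx0).
rewrite /= [(y - x) *: 1]mulr1 subrK.
set A := Rintegral _ _ _; set B := Rintegral _ _ _.
have BA : B - A = itg y x g.
  rewrite /A /B (@Rintegral_itvB _ _ -oo%O (BRight x) y (iGy x)) ?bnd_simp//.
    apply: eq_Rintegral => z; rewrite inE/= in_itv/= => /andP[yz zx].
    by rewrite /G patchE mem_set//= in_itv/= (lt_trans y0 yz) (le_trans zx (ltW _)).
  exact: ltW.
have -> : g x - (y - x)^-1 *: (A - B) = (g x * (x - y) - itg y x g) / (x - y).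
  rewrite -BA /GRing.scale/=; field.
  by rewrite yx0 subr_eq0 gt_eqF.
rewrite normrM normfV (gtr0_norm (_ : 0 < x - y)) ?subr_gt0//.
by rewrite ler_pdivrMr ?subr_gt0// distrC.
Qed.

End IntervalIntegrals.

(** * Stopping times, and flattening a function between a stopping time and [r] *)

Section StoppingTime.
Context {R : realType}.
Implicit Types (c k r x y T : R) (g : R -> R) (Q : set R).

(* Seeds run downwards from [r], so the first stop is a supremum; adjoining 0
   makes it 0 when [Q] never holds. *)
Definition stop_time r Q : R := sup ([set 0] `|` [set x | 0 < x < r /\ Q x]).

Lemma stop_time_has_sup r Q : 0 < r ->
  has_sup ([set 0] `|` [set x | 0 < x < r /\ Q x]).
Proof.
move=> r0; split; first by exists 0; left.
by exists r => x [->|[/andP[_ /ltW]]//]; exact: ltW.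
Qed.

Lemma stop_time_itv r Q : 0 < r -> 0 <= stop_time r Q <= r.
Proof.
move=> r0; apply/andP; split.
  by apply: ub_le_sup; [exact: (stop_time_has_sup Q r0).2|left].
apply: ge_sup; first by exists 0; left.
by move=> x [->|[/andP[_ /ltW]]//]; exact: ltW.
Qed.

Lemma stop_time_notin r Q y : 0 < r -> stop_time r Q < y -> y < r -> ~ Q y.
Proof.
move=> r0 Ty yr Qy; move: (Ty); apply/negP; rewrite -leNgt.
apply: ub_le_sup; first exact: (stop_time_has_sup Q r0).2.
right; split => //; rewrite yr andbT (le_lt_trans _ Ty)//.
by have /andP[] := stop_time_itv Q r0.
Qed.

Lemma stop_time_adherent r Q x : 0 < r -> 0 <= x -> x < stop_time r Q ->
  exists y, [/\ x < y, y < r, y <= stop_time r Q & Q y].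
Proof.
move=> r0 x0 xT.
have := sup_gt (stop_time_has_sup Q r0).1 xT.
case=> y [-> /(le_lt_trans x0)|[/andP[y0 yr] Qy] xy]; first by rewrite ltxx.
exists y; split => //; apply: ub_le_sup => //.
  exact: (stop_time_has_sup Q r0).2.
by right; split => //; rewrite y0.
Qed.

(** A stop above [x] is decided by the seeds in []x, r[] alone. Hence an outcome at a seed below the
    stop determines it. *)
Lemma stop_time_eq r Q Q' x : 0 < r -> 0 <= x -> x < stop_time r Q ->
  (forall y, x < y < r -> Q y <-> Q' y) -> stop_time r Q' = stop_time r Q.
Proof.
move=> r0 x0 xT QQ.
have le A B : x < stop_time r A ->
    (forall y, x < y < r -> A y -> B y) -> stop_time r A <= stop_time r B.
  move=> xA AB; rewrite leNgt; apply/negP => BA.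
  have /andP[B0 _] := stop_time_itv B r0.
  (* Some point of [A] lies above both [x] and the stop of [B]. It is also a point of [B], but none
     lies between the stop of [B] and [r]. *)
  have m0 : 0 <= Num.max x (stop_time r B) by rewrite le_max x0.
  have mA : Num.max x (stop_time r B) < stop_time r A by rewrite gt_max xA.
  have [y [+ yr _ Ay]] := stop_time_adherent r0 m0 mA.
  rewrite gt_max => /andP[xy By].
  by apply: (stop_time_notin r0 By yr); apply: AB => //; rewrite xy.
have QQ' : stop_time r Q <= stop_time r Q'.
  by apply: le => // y yr; move/QQ : yr => [].
apply/eqP; rewrite eq_le QQ' andbT; apply: le.
  exact: lt_le_trans QQ'.
by move=> y yr; move/QQ : yr => [].
Qed.

(** The integral is continuous in its lower endpoint, so a weak sign condition passes to the limit.
    The factor [k] covers both signs, with [k = 1] and [k = -1]. *)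
Lemma itg_ge0_limit g k r T : intble 0 1 g -> 0 <= T <= r -> r <= 1 ->
  (forall d, 0 < d ->
    exists y, [/\ 0 <= y <= r, `|y - T| < d & 0 <= k * itg y r g]) ->
  0 <= k * itg T r g.
Proof.
move=> ig /andP[T0 Tr] r1 H; rewrite leNgt; apply/negP => neg.
have igk : intble 0 1 (fun u => k * g u) by exact: intbleZ.
have E y : 0 <= y -> y <= r -> k * itg y r g = itg y r (fun u => k * g u).
  by move=> y0 yr; rewrite itgZ//; exact: intble_sub ig.
have e0 : 0 < - (k * itg T r g) by rewrite oppr_gt0.
have [d d0 Hd] := intble_abs_cont e0 igk.
have [y [/andP[y0 yr] yT]] := H d d0.
rewrite !E// in e0 Hd *.
have [yT'|Ty] := leP y T.
  rewrite (@itg_cat _ T)//; last exact: intble_sub igk.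
  have := Hd y T y0 yT' (le_trans Tr r1).
  rewrite distrC ger0_norm ?subr_ge0// in yT => /(_ yT).
  by rewrite ltr_norml => /andP[]; lra.
have := Hd T y T0 (ltW Ty) (le_trans yr r1).
rewrite gtr0_norm ?subr_gt0// in yT => /(_ yT).
have := @itg_cat _ y T r _ (ltW Ty) yr (intble_sub T0 r1 igk).
by move=> ->; rewrite ltr_norml => /andP[]; lra.
Qed.

(* At the single seed [T] the value is [c] rather than [g T + D / T]: stopping
   at [T] may only be visible at seeds strictly below [T]. *)
Definition flatten T D c r g (u : R) : R :=
  if r <= u then g u else if T <= u then c else g u + D / T.

Section flatten.
Context (T D c r : R) (g : R -> R) (ig : intble 0 1 g).
Context (T0 : 0 <= T) (Tr : T <= r) (r1 : r <= 1).
Let r0 : 0 <= r := le_trans T0 Tr.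
Let T1 : T <= 1 := le_trans Tr r1.

Let flatten1 : {in `]0, T[, (fun u => g u + D / T) =1 flatten T D c r g}.
Proof.
move=> u; rewrite in_itv/= => /andP[_ uT].
by rewrite /flatten !leNgt uT (lt_le_trans uT Tr).
Qed.

Let flatten2 : {in `]T, r[, (fun=> c) =1 flatten T D c r g}.
Proof.
move=> u; rewrite in_itv/= => /andP[Tu ur].
by rewrite /flatten leNgt ur (ltW Tu).
Qed.

Let flatten3 : {in `]r, 1[, g =1 flatten T D c r g}.
Proof.
by move=> u; rewrite in_itv/= => /andP[ru _]; rewrite /flatten (ltW ru).
Qed.

Let ig1 : intble 0 T (fun u => g u + D / T).
Proof. by apply: intbleD; [exact: intble_sub ig|exact: intble_cst]. Qed.
Let ig2 : intble T r (fun=> c). Proof. exact: intble_cst. Qed.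
Let ig3 : intble r 1 g. Proof. exact: intble_sub ig. Qed.

Lemma intble_flatten : intble 0 1 (flatten T D c r g).
Proof.
apply: (@intble_cat _ r) => //; last exact: intble_eq_oo ig3.
by apply: (@intble_cat _ T) => //;
  [exact: intble_eq_oo ig1|exact: intble_eq_oo ig2].
Qed.

(** The excess [D] removed from []T, r[] returns as the extra height [D / T] on []0, T[]. If [T = 0]
    there is no room for it, so it must vanish. *)
Lemma itg_flatten : D = itg T r (fun u => g u - c) -> (T = 0 -> D = 0) ->
  itg 0 1 (flatten T D c r g) = itg 0 1 g.
Proof.
move=> DE TD.
have ifl := intble_flatten.
rewrite [LHS](@itg_cat _ r)// [X in X + _](@itg_cat _ T)//; last first.
  exact: intble_sub ifl.
rewrite -(itg_eq_oo flatten1)// -(itg_eq_oo flatten2)// -(itg_eq_oo flatten3)//.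
rewrite [RHS](@itg_cat _ r)// [in RHS](@itg_cat _ T 0 r)//; last first.
  exact: intble_sub ig.
congr (_ + _).
rewrite itgD; [|exact: intble_sub ig|exact: intble_cst].
rewrite !itg_cst// subr0.
have -> : D / T * T = D.
  by have [/TD ->|/divfK] := eqVneq T 0; rewrite ?mul0r.
rewrite {}DE itgBcst//; last exact: intble_sub ig.
by ring.
Qed.

Context (ig_sqr : intble 0 1 (fun u => g u ^+ 2)).
Context (D0 : D = 0).

Let sflatten1 : {in `]0, T[,
  (fun u => g u ^+ 2) =1 (fun u => flatten T D c r g u ^+ 2)}.
Proof. by move=> u uT; rewrite -flatten1// D0 mul0r addr0. Qed.

Let sflatten2 : {in `]T, r[, (fun=> c ^+ 2) =1 (fun u => flatten T D c r g u ^+ 2)}.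
Proof. by move=> u uT; rewrite -flatten2. Qed.

Let sflatten3 : {in `]r, 1[,
  (fun u => g u ^+ 2) =1 (fun u => flatten T D c r g u ^+ 2)}.
Proof. by move=> u uT; rewrite -flatten3. Qed.

Let isg1 : intble 0 T (fun u => g u ^+ 2). Proof. exact: intble_sub ig_sqr. Qed.
Let isg2 : intble T r (fun=> c ^+ 2). Proof. exact: intble_cst. Qed.
Let isg3 : intble r 1 (fun u => g u ^+ 2). Proof. exact: intble_sub ig_sqr. Qed.

Lemma intble_flatten_sqr : intble 0 1 (fun u => flatten T D c r g u ^+ 2).
Proof.
apply: (@intble_cat _ r) => //; last exact: intble_eq_oo isg3.
by apply: (@intble_cat _ T) => //;
  [exact: intble_eq_oo isg1|exact: intble_eq_oo isg2].
Qed.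

Lemma intble_sqrBcst : intble 0 1 (fun u => (g u - c) ^+ 2).
Proof.
have -> : (fun u => (g u - c) ^+ 2) =
    (fun u => (g u ^+ 2 + (- (c *+ 2)) * g u) + c ^+ 2).
  by apply/funext => u; ring.
by do 2?[apply: intbleD] => //; [exact: intbleZ|exact: intble_cst].
Qed.

(** The zero excess kills the cross term of [(g u - c) ^+ 2], so the second moment falls by exactly
    the integral of this square. *)
Lemma itg_flatten_sqr : itg T r (fun u => g u - c) = 0 ->
  itg 0 1 (fun u => flatten T D c r g u ^+ 2) =
  itg 0 1 (fun u => g u ^+ 2) - itg T r (fun u => (g u - c) ^+ 2).
Proof.
move=> E0.
have ifl := intble_flatten_sqr.
rewrite [LHS](@itg_cat _ r)// [X in X + _](@itg_cat _ T)//; last first.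
  exact: intble_sub ifl.
rewrite -(itg_eq_oo sflatten1)// -(itg_eq_oo sflatten2)// -(itg_eq_oo sflatten3)//.
rewrite [in RHS](@itg_cat _ r 0 1)// [in RHS](@itg_cat _ T 0 r)//; last first.
  exact: intble_sub ig_sqr.
suff -> : itg T r (fun u => (g u - c) ^+ 2) =
    itg T r (fun u => g u ^+ 2) - itg T r (fun=> c ^+ 2) by ring.
have igT : intble T r g by exact: intble_sub ig.
have isT : intble T r (fun u => g u ^+ 2) by exact: intble_sub ig_sqr.
have -> : (fun u => (g u - c) ^+ 2) =
    (fun u => (g u ^+ 2 - c ^+ 2) - (c *+ 2) * (g u - c)).
  by apply/funext => u; ring.
have iB : intble T r (fun u => g u - c) by apply: intbleB => //; exact: intble_cst.
rewrite itgB; [|exact: intbleB|exact: intbleZ].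
by rewrite itgB// itgZ// E0 mulr0 subr0.
Qed.

Lemma itg_flatten_sqr_le : itg T r (fun u => g u - c) = 0 ->
  itg 0 1 (fun u => flatten T D c r g u ^+ 2) <= itg 0 1 (fun u => g u ^+ 2).
Proof.
move=> E0; rewrite itg_flatten_sqr// gerBl.
by apply: Rintegral_ge0 => u _; exact: sqr_ge0.
Qed.

(** By Jensen, a nonzero excess over []x, r]] forces a positive integral of [(g u - c) ^+ 2] there,
    and []T, x]] contributes at least 0. *)
Lemma itg_flatten_sqr_lt x : itg T r (fun u => g u - c) = 0 ->
  T <= x <= r -> itg x r (fun u => g u - c) != 0 ->
  itg 0 1 (fun u => flatten T D c r g u ^+ 2) < itg 0 1 (fun u => g u ^+ 2).
Proof.
move=> E0 /andP[Tx xr] Ex; rewrite itg_flatten_sqr// gtrBl.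
have x0 : 0 <= x by exact: le_trans Tx.
have is2 := intble_sqrBcst.
rewrite (@itg_cat _ x)//; last exact: intble_sub is2.
apply: ltr_wpDl; first by apply: Rintegral_ge0 => u _; exact: sqr_ge0.
have iB : intble x r (fun u => g u - c).
  by apply: intbleB; [exact: intble_sub ig|exact: intble_cst].
have := itg_jensen xr iB (intble_sub x0 r1 is2).
set J := (\int[mu]_(u in _) _)%R; set P := (\int[mu]_(u in _) _)%R => JP.
have J2 : 0 < J ^+ 2 by rewrite exprn_even_gt0.
have rx : 0 <= r - x by rewrite subr_ge0.
rewrite ltNge; apply/negP => P0.
have := lt_le_trans J2 JP; apply/negP; rewrite -leNgt.
by rewrite mulr_ge0_le0.
Qed.

End flatten.
End StoppingTime.

(** * The competing estimator built from a stopping rule *)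

Section Competitor.
Context {R : realType} {V : Type}.
Context (S : R -> V -> set V) (HS : monotone_sampling S) (f : V -> R).
Implicit Types (g h : R -> V -> R) (u x y r c : R) (v z : V).

Lemma sampling_eq x y v z : 0 < x -> x <= y -> y <= 1 -> S x v z ->
  S y z = S y v.
Proof.
move=> x0 xy y1 Sz.
have x01 : 0 < x <= 1 by rewrite x0 (le_trans xy).
have y01 : 0 < y <= 1 by rewrite y1 (lt_le_trans x0).
apply: (sampling_consistent HS y01).
exact: (sampling_mono HS x01 y01 xy) Sz.
Qed.

Lemma estimator_eq g x y v z : estimator S g -> 0 < x -> x <= y -> y <= 1 ->
  S x v z -> g y z = g y v.
Proof.
move=> [g_out _] x0 xy y1 Sz.
have y01 : 0 < y <= 1 by rewrite y1 (lt_le_trans x0).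
apply: g_out => //; rewrite -(sampling_eq x0 xy y1 Sz).
exact: (sampling_refl HS).
Qed.

Lemma itg_estimator_eq g x v z (phi : R -> R) b : estimator S g -> 0 < x ->
  b <= 1 -> S x v z ->
  itg x b (fun u => phi (g u z)) = itg x b (fun u => phi (g u v)).
Proof.
move=> Eg x0 b1 Sz; apply: eq_Rintegral => u; rewrite inE/= in_itv/=.
move=> /andP[xu ub]; congr phi.
exact: (estimator_eq Eg x0 (ltW xu) (le_trans ub b1) Sz).
Qed.

(** At seeds above [x] the estimates for [z] are those for [v]; those below are nonnegative, and
    together they integrate to [f z]. *)
Lemma sampled_mass_le g x v z : nonneg_unbiased S f g -> 0 < x -> x <= 1 ->
  S x v z -> itg x 1 (g ^~ v) <= f z.
Proof.
move=> [Eg g0 gf] x0 x1 Sz.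
rewrite -(itg_estimator_eq id Eg x0 (lexx 1) Sz) -(gf z).
rewrite [leRHS](@itg_cat _ x)//; [|exact: ltW|exact: Eg.2].
rewrite lerDr; apply: Rintegral_ge0 => u /=; rewrite in_itv/= => /andP[u0 ux].
by apply: g0; rewrite u0 (le_trans ux).
Qed.

Context (f_ge0 : forall v, 0 <= f v).

Let inf_has_inf x v : 0 < x -> x <= 1 -> has_inf [set f z | z in S x v].
Proof.
move=> x0 x1; split.
  by exists (f v), v => //; apply: (sampling_refl HS); rewrite x0.
by exists 0 => _ [z _ <-].
Qed.

Lemma lower_bound_le x v z : 0 < x -> x <= 1 -> S x v z ->
  lower_bound S f v x <= f z.
Proof.
move=> x0 x1 Sz; apply: ge_inf; first exact: (inf_has_inf v x0 x1).2.
by exists z.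
Qed.

Lemma lower_bound_ge x v k : 0 < x -> x <= 1 ->
  (forall z, S x v z -> k <= f z) -> k <= lower_bound S f v x.
Proof.
move=> x0 x1 H; apply: lb_le_inf; first exact: (inf_has_inf v x0 x1).1.
by move=> _ [z Sz <-]; exact: H.
Qed.

Lemma lower_bound_lt x v k : 0 < x -> x <= 1 -> lower_bound S f v x < k ->
  exists2 z, S x v z & f z < k.
Proof.
move=> x0 x1 /(inf_lt (inf_has_inf v x0 x1).1)[_ [z Sz <-]] fz.
by exists z.
Qed.

Context (g : R -> V -> R) (Hg : nonneg_unbiased S f g).
Context (r : R) (r0 : 0 < r) (r1 : r <= 1) (v : V) (c : R) (c0 : 0 <= c).
Context (Q : R -> V -> Prop).
Context (Q_out : forall x z z', S r v z -> 0 < x < r -> S x z z' ->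
  Q x z <-> Q x z').

Let T z := stop_time r (Q ^~ z).
Let excess z := itg (T z) r (fun u => g u z - c).

Context (excess_ge0 : forall z, S r v z -> 0 <= excess z).
Context (excess_eq0 : forall z, S r v z -> T z = 0 -> excess z = 0).

(** Each [z] consistent with [v] at seed [r] has its own stop and excess; all other data keep their
    estimates. *)
Definition competitor u z : R :=
  if `[< S r v z >] then flatten (T z) (excess z) c r (g ^~ z) u else g u z.

Let Tr z : 0 <= T z /\ T z <= r.
Proof. by apply/andP; exact: stop_time_itv. Qed.

Let S_iff u z z' : 0 < u < r -> S u z z' -> S r v z -> S r v z'.
Proof.
move=> /andP[u0 ur] Sz Srz.
have rr : 0 < r <= 1 by rewrite r0.
rewrite -(sampling_consistent HS rr Srz) -(sampling_eq u0 (ltW ur) r1 Sz).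
exact: sampling_refl.
Qed.

Let S_sym u z z' : 0 < u < r -> S u z z' -> S u z' z.
Proof.
move=> /andP[u0 ur] Sz.
have uu : 0 < u <= 1 by rewrite u0 ltW// (lt_le_trans ur).
by rewrite (sampling_consistent HS uu Sz); exact: sampling_refl.
Qed.

(** Both data have the same outcomes at seeds in []u, r[], so [Q] agrees there, and the stop of [z]
    lies above [u]. *)
Let T_eq u z z' : 0 < u < r -> S u z z' -> S r v z -> u < T z -> T z' = T z.
Proof.
move=> /andP[u0 ur] Sz Srz uT; apply: (@stop_time_eq _ _ _ _ u) => //.
  exact: ltW.
move=> y /andP[uy yr]; have y0 := lt_trans u0 uy.
have y1 : y <= 1 by exact: le_trans (ltW yr) r1.
apply: Q_out => //; first by rewrite y0.
by apply: (sampling_mono HS _ _ (ltW uy)) Sz; rewrite ?u0 ?y0//= (le_trans (ltW uy)).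
Qed.

Let competitor_out u z z' : 0 < u <= 1 -> S u z z' ->
  competitor u z' = competitor u z.
Proof.
move=> /andP[u0 u1] Sz; rewrite /competitor /flatten.
have gu : g u z' = g u z by have [Eg _ _] := Hg; exact: (estimator_eq Eg u0 _ u1 Sz).
rewrite gu; have [_|ur] := leP r u; first by rewrite !if_same.
have ur' : 0 < u < r by rewrite u0.
have Sz' := S_sym ur' Sz.
have E : S r v z' = S r v z.
  by rewrite propeqE; split; [exact: (S_iff ur' Sz')|exact: (S_iff ur' Sz)].
rewrite E; case: asboolP => // Srz.
(* Below the stop, stop and excess can be read off the outcome. Otherwise both data get [c], because
   [u < T z'] would by symmetry give [u < T z]. *)
have [uT|Tu] := ltP u (T z).
  rewrite (T_eq ur' Sz Srz uT) leNgt uT /=; congr (_ + _ / _).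
  have [Eg _ _] := Hg.
  rewrite /excess (T_eq ur' Sz Srz uT).
  apply: (itg_estimator_eq (fun t => t - c) Eg (lt_trans u0 uT) r1).
  have Tz1 : T z <= 1 by exact: le_trans (Tr z).2 r1.
  by apply: (sampling_mono HS _ _ (ltW uT)) Sz; rewrite ?u0// (lt_trans u0 uT).
have [uT'|//] := ltP u (T z').
have Srz' : S r v z' by rewrite E.
by move: Tu; rewrite (T_eq ur' Sz' Srz' uT') leNgt uT'.
Qed.

Lemma competitor_nonneg_unbiased : nonneg_unbiased S f competitor.
Proof.
have [[_ ig] g0 gf] := Hg.
split.
- split; first by move=> u z z'; exact: competitor_out.
  move=> z; rewrite /competitor; case: asboolP => // _.
  exact: (intble_flatten _ _ (ig z) (Tr z).1 (Tr z).2 r1).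
- move=> u z u01; rewrite /competitor; case: asboolP => [Sz|_]; last exact: g0.
  rewrite /flatten; case: ifP => _; first exact: g0.
  case: ifP => // _; apply: addr_ge0; first exact: g0.
  by apply: divr_ge0; [exact: excess_ge0|exact: (Tr z).1].
- move=> z; rewrite -(gf z) /competitor; case: asboolP => // Sz.
  exact: (itg_flatten (ig z) (Tr z).1 (Tr z).2 r1 erefl (excess_eq0 Sz)).
Qed.

Lemma variance_itg h z : intble 0 1 (fun u => h u z ^+ 2) ->
  Defs.variance f h z = (itg 0 1 (fun u => h u z ^+ 2) - f z ^+ 2)%:E.
Proof.
by move=> i2; rewrite /Defs.variance EFinB /Rintegral fineK//; exact: integrable_fin_num.
Qed.

Lemma finite_variance_intble h z : estimator S h ->
  (Defs.variance f h z < +oo)%E -> intble 0 1 (fun u => h u z ^+ 2).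
Proof.
move=> [_ ih] vf; apply/integrableP; split.
  have /integrableP[/measurable_EFinP mh _] := ih z.
  apply/measurable_EFinP; exact: measurable_funX.
under eq_integral do rewrite /= ger0_norm ?sqr_ge0//.
move: vf; rewrite /Defs.variance.
by case: integral => // s _; exact: ltry.
Qed.

Context (Hfin : finite_variance f g).

Let sqr_intble z : intble 0 1 (fun u => g u z ^+ 2).
Proof. by have [Eg _ _] := Hg; apply: finite_variance_intble. Qed.

Let variance_competitor z : S r v z -> excess z = 0 ->
  Defs.variance f competitor z =
  (itg 0 1 (fun u => flatten (T z) (excess z) c r (g ^~ z) u ^+ 2) - f z ^+ 2)%:E.
Proof.
move=> Sz e0.
have E : (fun u => competitor u z ^+ 2) =
    (fun u => flatten (T z) (excess z) c r (g ^~ z) u ^+ 2).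
  by apply/funext => u; rewrite /competitor asboolT.
rewrite variance_itg E//.
exact: (intble_flatten_sqr _ (Tr z).1 (Tr z).2 r1 (sqr_intble z) e0).
Qed.

(** Data outside [S r v] keep their variance, so the excess matters only inside it. *)
Lemma variance_competitor_le z : (S r v z -> excess z = 0) ->
  (Defs.variance f competitor z <= Defs.variance f g z)%E.
Proof.
have [Sz /(_ Sz) e0|NSz _] := pselect (S r v z); last first.
  by rewrite /Defs.variance /competitor asboolF.
have [[_ ig] _ _] := Hg.
rewrite variance_competitor// variance_itg// lee_fin lerD2r.
exact: (itg_flatten_sqr_le (ig z) (Tr z).1 (Tr z).2 r1 (sqr_intble z) e0 e0).
Qed.

Lemma variance_competitor_lt x z : S r v z -> excess z = 0 ->
  T z <= x <= r -> itg x r (fun u => g u z - c) != 0 ->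
  (Defs.variance f competitor z < Defs.variance f g z)%E.
Proof.
move=> Sz e0 Tx xr; have [[_ ig] _ _] := Hg.
rewrite variance_competitor// variance_itg// lte_fin ltrD2r.
exact: (itg_flatten_sqr_lt (ig z) (Tr z).1 (Tr z).2 r1 (sqr_intble z) e0 e0 Tx).
Qed.

End Competitor.

(** * Approaching a stopping time from points inside and outside the stopping set *)

Section LimitsAtStoppingTime.
Context {R : realType}.
Implicit Types (d r : R) (P Q : set R).

(** A positive stop is approached by points of [Q]. At the stop 0 there are none, and [P 0] is
    supplied separately. *)
Lemma stop_time_limit_in r Q P : 0 < r -> (stop_time r Q = 0 -> P 0) ->
  (forall y, 0 < y -> y < r -> Q y -> P y) ->
  forall d, 0 < d ->
    exists y, [/\ 0 <= y <= r, `|y - stop_time r Q| < d & P y].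
Proof.
move=> r0 P0 QP d d0; have /andP[T0 Tr] := stop_time_itv Q r0.
have [Tpos|] := ltP 0 (stop_time r Q); last first.
  move=> T0'; have TE : stop_time r Q = 0 by apply/eqP; rewrite eq_le T0' T0.
  by exists 0; rewrite lexx ltW// TE subr0 normr0; split => //; exact: P0.
have m0 : 0 <= Num.max 0 (stop_time r Q - d) by rewrite le_max lexx.
have mT : Num.max 0 (stop_time r Q - d) < stop_time r Q.
  by rewrite gt_max Tpos ltrBlDr ltrDl.
have [y [+ yr yT Qy]] := stop_time_adherent r0 m0 mT.
rewrite gt_max => /andP[y0 dy]; exists y; split.
- by rewrite (ltW y0) (ltW yr).
- by rewrite distrC ger0_norm ?subr_ge0// ltrBlDr -ltrBlDl.
- exact: QP.
Qed.

Lemma stop_time_limit_out r Q : 0 < r -> stop_time r Q < r ->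
  forall d, 0 < d ->
    exists y, [/\ 0 <= y <= r, `|y - stop_time r Q| < d, y < r & ~ Q y].
Proof.
move=> r0 Tr d d0; have /andP[T0 _] := stop_time_itv Q r0.
set T := stop_time r Q in T0 Tr *.
pose e := Num.min d (r - T) / 2.
have e0 : 0 < e by rewrite divr_gt0// lt_min d0 subr_gt0.
have [ed er] : e < d /\ e < r - T.
  have : e < Num.min d (r - T) by rewrite /e; move: e0; rewrite /e; lra.
  by rewrite lt_min => /andP.
exists (T + e); split.
- by apply/andP; split; lra.
- by rewrite addrC addKr gtr0_norm.
- by lra.
- by apply: (stop_time_notin r0); rewrite -/T; lra.
Qed.

End LimitsAtStoppingTime.

(** * Optimality forces the L* equation at left density points *)

Section Optimality.
Context {R : realType} {V : Type}.
Context (S : R -> V -> set V) (HS : monotone_sampling S) (f : V -> R).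
Context (f_ge0 : forall v, 0 <= f v) (g : R -> V -> R).
Context (Hfin : finite_variance f g).
Context (Hopt : prec_plus_optimal S f (fun v v' : V => f v < f v') g).

Let Hg : nonneg_unbiased S f g := Hopt.1.
Let Eg : estimator S g. Proof. by case: Hg. Qed.
Let ig z : intble 0 1 (g ^~ z). Proof. exact: Eg.2. Qed.

Let no_better h z0 : nonneg_unbiased S f h ->
  (Defs.variance f h z0 < Defs.variance f g z0)%E ->
  (forall z, f z < f z0 ->
    (Defs.variance f h z <= Defs.variance f g z)%E) -> False.
Proof.
by move=> Hh lt le; apply: Hopt.2; exists h; split => //; exists z0; split.
Qed.

Context (r : R) (r0 : 0 < r) (r1 : r < 1) (v : V).
Context (density : forall e, 0 < e -> exists2 d, 0 < d &
  forall y, 0 < y -> r - d < y -> y < r ->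
    `|itg y r (g ^~ v) - g r v * (r - y)| <= e * (r - y)).

Let M := itg r 1 (g ^~ v).
Let E c z y := itg y r (fun u => g u z - c).
Let r1' : r <= 1 := ltW r1.
Let rr : 0 < r <= 1. Proof. by rewrite r0. Qed.

Let itgr z y : 0 <= y -> y <= r -> S r v z ->
  itg y r (g ^~ z) = itg y 1 (g ^~ z) - M.
Proof.
move=> y0 yr Sz; rewrite (@itg_cat _ r y 1)//; last exact: intble_sub (ig z).
by rewrite (itg_estimator_eq HS id Eg r0 (lexx 1) Sz) addrK.
Qed.

Let EE c z y : 0 <= y -> y <= r ->
  E c z y = itg y r (g ^~ z) - c * (r - y).
Proof.
by move=> y0 yr; rewrite /E itgBcst//; exact: intble_sub (ig z).
Qed.

(** Unbiasedness evaluates the excess at seed 0. *)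
Let E0 c z : S r v z -> E c z 0 = f z - M - c * r.
Proof.
move=> Sz; rewrite EE ?(ltW r0)// subr0 itgr ?(ltW r0)//.
by case: Hg => _ _ ->.
Qed.

Let iE c z : intble 0 1 (fun u => g u z - c).
Proof. by apply: intbleB => //; exact: intble_cst. Qed.

Let E_ge0_limit c z T : 0 <= T <= r -> (forall d, 0 < d ->
    exists y, [/\ 0 <= y <= r, `|y - T| < d & 0 <= E c z y]) -> 0 <= E c z T.
Proof.
move=> Tr H; have := @itg_ge0_limit _ _ 1 _ _ (iE c z) Tr r1'.
rewrite mul1r; apply=> d /H[y [? ? ?]]; exists y; split => //.
by rewrite mul1r.
Qed.

Let E_le0_limit c z T : 0 <= T <= r -> (forall d, 0 < d ->
    exists y, [/\ 0 <= y <= r, `|y - T| < d & E c z y <= 0]) -> E c z T <= 0.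
Proof.
move=> Tr H; rewrite -oppr_ge0 -mulN1r; apply: (itg_ge0_limit (iE c z) Tr r1').
move=> d /H[y [? ? ?]]; exists y; split => //.
by rewrite mulN1r oppr_ge0.
Qed.

Let Er c z : E c z r = 0. Proof. exact: itg_xx. Qed.

Let eq_or_lt t : 0 <= t <= r -> t = r \/ t < r.
Proof. by move=> /andP[_]; rewrite le_eqVlt => /predU1P. Qed.

(** Every [z] consistent with [v] at [r] has [f z] at least the lower bound, so its excess is
    nonnegative at seed 0 and returns to exactly 0 at the stop. *)
Lemma optimal_ge : (lower_bound S f v r - M) / r <= g r v.
Proof.
rewrite leNgt; apply/negP; set c := (_ / _) => gc.
have c0 : 0 <= c by rewrite ltW// (le_lt_trans _ gc)//; case: Hg => _ + _; apply.
have cr : c * r = lower_bound S f v r - M by rewrite divfK ?gt_eqF.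
pose Q x z := 0 <= E c z x.
pose T z := stop_time r (Q ^~ z).
have Tr z : 0 <= T z <= r by exact: stop_time_itv.
have Ez0 z : S r v z -> 0 <= E c z 0.
  move=> Sz; rewrite E0// cr.
  by have := lower_bound_le HS f_ge0 r0 r1' Sz; lra.
(* If [T z < r], the excess is negative just above the stop. It is nonnegative at nearby points of
   [Q], or at seed 0 by [Ez0]; continuity leaves only 0. *)
have ET0 z : S r v z -> E c z (T z) = 0.
  move=> Sz; apply/eqP; rewrite eq_le; apply/andP; split.
  - have [->|Tltr] := eq_or_lt (Tr z); first by rewrite Er.
    apply: E_le0_limit => // d d0.
    have [y [yr yT _ /negP]] := stop_time_limit_out r0 Tltr d0.
    by rewrite -ltNge => /ltW ?; exists y.
  - apply: E_ge0_limit => //; apply: stop_time_limit_in => //.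
    by move=> _; exact: Ez0.
have Hc := @competitor_nonneg_unbiased _ _ _ HS f g Hg r r0 r1' v c c0 Q.
(* An error of half the gap keeps the average of the estimate over []y, r]] below [c] for [y] just
   below [r]. *)
have e0 : 0 < (c - g r v) / 2 by rewrite divr_gt0// subr_gt0.
have [d d0 Hd] := density e0.
have Eneg y : Num.max 0 (r - d) < y -> y < r -> E c v y < 0.
  rewrite gt_max => /andP[y0 dy] yr; have := Hd y y0 dy yr.
  rewrite EE ?(ltW y0) ?(ltW yr)// ler_norml => /andP[_].
  by have : 0 < (c - g r v) * (r - y); [rewrite mulr_gt0 ?subr_gt0|lra].
pose m := Num.max 0 (r - d).
have mr : m < r by rewrite gt_max r0/=; lra.
have m0 : 0 <= m by rewrite le_max lexx.
have Tm : T v <= m.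
  rewrite leNgt; apply/negP => mT.
  have [y [my yr _]] := stop_time_adherent r0 m0 mT.
  by rewrite /Q leNgt Eneg.
pose x := (m + r) / 2.
have [mx xr] : m < x /\ x < r by rewrite /x; split; lra.
apply: (no_better (h := competitor S g r v c Q) (z0 := v)).
- apply: Hc => //.
  + move=> y z z' Sz /andP[y0 yr] Syz; rewrite /Q /E.
    by rewrite (itg_estimator_eq HS (fun t => t - c) Eg y0 r1' Syz).
  + by move=> z Sz; rewrite [leRHS](ET0 z Sz).
  + by move=> z Sz _; exact: ET0.
- apply: (variance_competitor_lt Hg r0 r1' Hfin (x := x)).
  + exact: sampling_refl.
  + by apply: ET0; exact: sampling_refl.
  + by rewrite (le_trans Tm (ltW mx)) (ltW xr).
  + by rewrite lt_eqF//; apply: Eneg.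
- move=> z _; apply: (variance_competitor_le Hg r0 r1' Hfin) => Sz.
  exact: ET0.
Qed.

Lemma optimal_le : g r v <= (lower_bound S f v r - M) / r.
Proof.
(* The assumption reads [lower_bound S f v r < g r v * r + M]. A [z0] with [f z0] below the right
   side makes the slope [c] smaller than [g r v]. *)
rewrite leNgt; apply/negP; rewrite ltr_pdivrMr// ltrBlDr => /[dup] lbg.
move=> /(lower_bound_lt HS f_ge0 r0 r1')[z0 Sz0 fz0].
pose c := (f z0 - M) / r.
have cr : c * r = f z0 - M by rewrite divfK ?gt_eqF.
have c0 : 0 <= c.
  by rewrite divr_ge0 ?(ltW r0)// subr_ge0 (sampled_mass_le HS Hg r0 r1' Sz0).
have gc : c < g r v by rewrite ltr_pdivrMr// ltrBlDr.
(* The second disjunct says that the outcome already rules out all data that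
   precede [z0]; the variances of the remaining data do not matter. *)
pose Q x z := E c z x <= 0 \/ f z0 < lower_bound S f z x.
pose T z := stop_time r (Q ^~ z).
have Tr z : 0 <= T z <= r by exact: stop_time_itv.
have ET_ge0 z : 0 <= E c z (T z).
  have [->|Tltr] := eq_or_lt (Tr z); first by rewrite Er.
  apply: E_ge0_limit => // d d0.
  have [y [yr yT _ nQ]] := stop_time_limit_out r0 Tltr d0.
  exists y; split => //; rewrite leNgt; apply/negP => Ey.
  by apply: nQ; left; exact: ltW.
(* If [f z <= f z0], the lower bound never exceeds [f z0], so only the first disjunct of [Q] can
   stop; at seed 0 the excess is [f z - f z0]. *)
have ET_le0 z : S r v z -> f z <= f z0 -> E c z (T z) <= 0.
  move=> Sz fz; apply: E_le0_limit => //; apply: stop_time_limit_in => //.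
    by move=> _; rewrite E0// cr; lra.
  move=> y y0 yr [//|]; rewrite ltNge => /negP[].
  have y1 : y <= 1 by exact: le_trans (ltW yr) r1'.
  have Sy : S y z z by apply: (sampling_refl HS); rewrite y0.
  exact: le_trans (lower_bound_le HS f_ge0 y0 y1 Sy) fz.
have ET0 z : S r v z -> f z <= f z0 -> E c z (T z) = 0.
  by move=> Sz fz; apply/eqP; rewrite eq_le ET_ge0 ET_le0.
(* Without a stop, lower bounds at small seeds [y] stay at most [f z0] and dominate the mass sampled
   above [y]. The mass below [y] tends to 0, so [f z <= f z0]. *)
have T_eq0 z : S r v z -> T z = 0 -> f z <= f z0.
  move=> Sz Tz; rewrite leNgt; apply/negP => fz.
  have e0 : 0 < f z - f z0 by rewrite subr_gt0.
  have [d d0 Hd] := intble_abs_cont e0 (ig z).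
  pose y := Num.min d r / 2.
  have m0 : 0 < Num.min d r by rewrite lt_min d0.
  have y0 : 0 < y by rewrite divr_gt0.
  have [yd yr] : y < d /\ y < r.
    have : y < Num.min d r by rewrite /y; lra.
    by rewrite lt_min => /andP.
  have y1 : y <= 1 by exact: le_trans (ltW yr) r1'.
  have nQ : ~ Q y z 
    by apply: (@stop_time_notin _ r (Q ^~ z)) => //; rewrite -/(T z) Tz.
  have lb : lower_bound S f z y <= f z0.
    by rewrite leNgt; apply/negP => H; apply: nQ; right.
  have My : itg y 1 (g ^~ z) <= lower_bound S f z y.
    apply: (lower_bound_ge HS f_ge0 y0 y1) => z' Sz'.
    exact: (sampled_mass_le HS Hg y0 y1 Sz').
  have := Hd 0 y (lexx 0) (ltW y0) y1; rewrite subr0 => /(_ yd).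
  rewrite ltr_norml => /andP[_].
  have fE : f z = itg 0 1 (g ^~ z) by case: Hg => _ _ ->.
  rewrite [in X in _ < X -> _]fE (@itg_cat _ y 0 1)// ?(ltW y0)//.
  lra.
(* The standing assumption keeps [z0] consistent with [v] slightly below [r], so the density of [v]
   at [r] transfers to [z0]. *)
have [e1 e10 Hopen] := sampling_open HS rr Sz0.
have e0 : 0 < (g r v - c) / 2 by rewrite divr_gt0// subr_gt0.
have [d d0 Hd] := density e0.
pose m := Num.max 0 (Num.max (r - d) (r - e1)).
have Epos y : m < y -> y < r -> 0 < E c z0 y.
  rewrite !gt_max => /and3P[y0 dy e1y] yr; have := Hd y y0 dy yr.
  have Sy : S y v z0.
    by apply: Hopen => //; rewrite y0 (le_trans (ltW yr)).
  rewrite EE ?(ltW y0) ?(ltW yr)// (itg_estimator_eq HS id Eg y0 r1' Sy).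
  rewrite ler_norml => /andP[+ _].
  by have : 0 < (g r v - c) * (r - y); [rewrite mulr_gt0 ?subr_gt0|lra].
have mr : m < r by rewrite !gt_max r0/=; apply/andP; split; lra.
have m0 : 0 <= m by rewrite le_max lexx.
(* On []m, r[] neither disjunct holds for [z0]: its excess is positive and its lower bound is at
   most [f z0]. *)
have Tm : T z0 <= m.
  rewrite leNgt; apply/negP => mT.
  have [y [my yr _ [|]]] := stop_time_adherent r0 m0 mT.
    by rewrite leNgt Epos.
  have y0 : 0 < y by exact: le_lt_trans my.
  have y1 : y <= 1 by exact: le_trans (ltW yr) r1'.
  have Sy : S y z0 z0 by apply: (sampling_refl HS); rewrite y0.
  by rewrite ltNge (lower_bound_le HS f_ge0 y0 y1 Sy).
pose x := (m + r) / 2.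
have [mx xr] : m < x /\ x < r by rewrite /x; split; lra.
apply: (no_better (h := competitor S g r v c Q) (z0 := z0)).
- apply: (competitor_nonneg_unbiased HS Hg r0 r1' c0).
  + move=> y z z' Sz /andP[y0 yr] Syz; rewrite /Q /E /lower_bound.
    rewrite (itg_estimator_eq HS (fun t => t - c) Eg y0 r1' Syz).
    by rewrite (sampling_eq HS y0 (lexx y) (le_trans (ltW yr) r1') Syz).
  + by move=> z Sz; exact: ET_ge0.
  + by move=> z Sz Tz; apply: ET0 => //; exact: T_eq0.
- apply: (variance_competitor_lt Hg r0 r1' Hfin (x := x)) => //.
  + exact: ET0.
  + by rewrite (le_trans Tm (ltW mx)) (ltW xr).
  + by rewrite gt_eqF//; apply: Epos.
- move=> z fz; apply: (variance_competitor_le Hg r0 r1' Hfin) => Sz.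
  exact: ET0 Sz (ltW fz).
Qed.

End Optimality.

(** * Uniqueness for the homogeneous Volterra equation *)

Section Volterra.
Context {R : realType}.
Context (d : R -> R) (d_int : forall x, 0 < x -> intble x 1 d).
Context (dE : {ae mu, forall x, 0 < x < 1 -> x * d x = - itg x 1 d}).

(* On a window of length [x0 / 2] the equation contracts the sup norm of the
   tail integral by a factor 2. *)
Let tail0_step x0 b : 0 < x0 -> x0 <= b -> b <= 1 -> itg b 1 d = 0 ->
  forall x, x0 <= x -> x <= b -> b - x <= x0 / 2 -> itg x 1 d = 0.
Proof.
move=> x00 xb b1 Db0 x x0x xleb bx.
have D y : x <= y -> y <= b -> itg y 1 d = itg y b d.
  move=> xy yb; rewrite (@itg_cat _ b y 1)// ?Db0 ?addr0//.
  exact: (intble_sub (le_trans x0x xy) (lexx 1) (d_int x00)).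
pose A := [set `|itg y 1 d| | y in `[x, b]].
have supA : has_sup A.
  split; first by exists `|itg x 1 d|, x => //=; rewrite in_itv/= lexx.
  exists (itg x 1 (fun u => `|d u|)) => z [y /=]; rewrite in_itv/= => /andP[xy yb] <-.
  have idx : intble x 1 d by apply: d_int; exact: lt_le_trans x0x.
  have idn : intble x 1 (fun u => `|d u|) by exact: integrable_norm.
  rewrite (@itg_cat _ y x 1)// ?(le_trans yb)//.
  apply: le_trans (le_normr_Rintegral _ _) _ => //.
    exact: (intble_sub xy (lexx 1) idx).
  by rewrite lerDr; apply: Rintegral_ge0.
have Ay y : x <= y -> y <= b -> `|itg y 1 d| <= sup A.
  move=> xy yb; apply: ub_le_sup; first exact: supA.2.
  by exists y => //=; rewrite in_itv/= xy.
have A0 : 0 <= sup A by apply: le_trans (Ay x (lexx x) xleb).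
(* Almost everywhere on the window [d] is a tail integral divided by a seed at least [x0], so it is
   bounded by [sup A / x0]; the window has length at most [x0 / 2]. *)
have : sup A <= sup A / 2.
  apply: ge_sup; first exact: supA.1.
  move=> z [y /=]; rewrite in_itv/= => /andP[xy yb] <-; rewrite D//.
  apply: (@le_trans _ _ (sup A / x0 * (b - y))).
    apply: itg_ae_bound => //; first by rewrite divr_ge0// ltW.
      apply: (intble_sub (le_trans x0x xy) b1 (d_int x00)).
    apply: (@filterS _ _ (ae_filter_ringOfSetsType mu)) dE => u du /andP[yu ub].
    have xu : x < u by exact: le_lt_trans yu.
    have u0 : 0 < u by rewrite (lt_trans x00)// (le_lt_trans x0x).
    have /du dE' : 0 < u < 1 by rewrite u0 (lt_le_trans ub).
    rewrite ler_pdivlMr// mulrC; apply: (@le_trans _ _ `|itg u 1 d|).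
      rewrite -[leRHS]normrN -dE' normrM (gtr0_norm u0) ler_wpM2r//.
      exact: le_trans (ltW xu).
    by apply: Ay; exact: ltW.
  rewrite -mulrA ler_wpM2l// ler_pdivrMl//.
  by apply: le_trans bx; rewrite lerD2l lerN2.
move=> AA; apply/eqP; rewrite -normr_le0.
by apply: (le_trans (Ay x (lexx x) xleb)); lra.
Qed.

(** Windows of fixed length [x / 2] lead down from 1; [n] counts them, and finitely many reach
    [x]. *)
Lemma volterra_tail0 x : 0 < x -> x <= 1 -> itg x 1 d = 0.
Proof.
move=> x0 x1.
have H (n : nat) : forall y, x <= y -> y <= 1 -> 1 - y <= n%:R * (x / 2) ->
    itg y 1 d = 0.
  elim: n => [|n IH] y xy y1 yn.
    have -> : y = 1 by apply/eqP; rewrite eq_le y1; move: yn; rewrite mul0r subr_le0.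
    exact: itg_xx.
  have [yn'|ny] := leP (1 - y) (n%:R * (x / 2)); first exact: IH.
  pose b := 1 - n%:R * (x / 2).
  have nx0 : 0 <= n%:R * (x / 2) by rewrite mulr_ge0// divr_ge0// ltW.
  have yb : y <= b by rewrite /b; lra.
  have b1 : b <= 1 by rewrite /b; lra.
  apply: (@tail0_step x b) => //; first exact: le_trans yb.
    by apply: IH => //; [exact: le_trans yb|rewrite /b; lra].
  by move: yn; rewrite -natr1 mulrDl mul1r /b; lra.
apply: (H (Num.bound (2 / x))) => //.
have : 2 / x <= (Num.bound (2 / x))%:R.
  by apply/ltW/archi_boundP; rewrite divr_ge0// ltW.
rewrite ler_pdivrMr// => Hn.
by rewrite mulrA ler_pdivlMr//; lra.
Qed.

Lemma volterra_ae0 : {ae mu, forall x, 0 < x < 1 -> d x = 0}.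
Proof.
apply: (@filterS _ _ (ae_filter_ringOfSetsType mu)) dE => x dx /[dup] /dx.
move=> + /andP[x0 x1]; rewrite volterra_tail0// ?(ltW x1)// oppr0.
by move/eqP; rewrite mulf_eq0 gt_eqF//= => /eqP.
Qed.

End Volterra.

(** * Both estimators solve the L* equation almost everywhere, hence agree *)

Theorem theorem4p3 (R : realType) (V : Type) (S : R -> V -> set V) (f : V -> R)
    (HS : monotone_sampling S) (f_ge0 : forall v : V, 0 <= f v)
    (fL : R -> V -> R) (HL : is_Lstar S f fL)
    (fhat : R -> V -> R) (Hfin : finite_variance f fhat)
    (Hopt : prec_plus_optimal S f (fun v v' : V => f v < f v') fhat) :
  equivalent fhat fL.
Proof.
move=> v;
have [[[_ ig] _ _] _] := Hopt.
have ighat x : 0 < x -> mu.-integrable `]x, 1] (EFin \o (fhat ^~ v)).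
  by move=> x0; apply: intble_sub (ig v) => //; exact: ltW.
have igL x : 0 < x -> mu.-integrable `]x, 1] (EFin \o (fL ^~ v)).
  move=> x0; have [x1|x1] := leP x 1; last first.
    by rewrite set_itv_ge ?bnd_simp -?leNgt ?(ltW x1)//; exact: integrable_set0.
  have [|iL _] := HL v x; first by rewrite x0.
  by apply: integrableS iL => //; apply: subset_itvr; rewrite bnd_simp.
have dint x : 0 < x ->
    mu.-integrable `]x, 1] (EFin \o (fun u => fhat u v - fL u v)).
  by move=> x0; apply: intbleB; [exact: ighat|exact: igL].
have Hat : {ae mu, forall x, 0 < x < 1 -> x * (fhat x v - fL x v) =
    - \int[mu]_(u in `]x, 1]) (fhat u v - fL u v)}.
  apply: (@filterS _ _ (ae_filter_ringOfSetsType mu)) (ae_left_density (ig v)).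
  move=> x Hd /[dup] x01 /Hd density; have /andP[x0 x1] := x01.
  (* At a left density point the two optimality bounds meet in the L* equation. *)
  have fhatE : fhat x v =
      (lower_bound S f v x - \int[mu]_(u in `]x, 1]) fhat u v) / x.
    apply/eqP; rewrite eq_le.
    rewrite (optimal_le HS f_ge0 Hfin Hopt x0 x1 density).
    by rewrite (optimal_ge HS f_ge0 Hfin Hopt x0 x1 density).
  have [|_ fLE] := HL v x; first by rewrite x0 ltW.
  rewrite fhatE fLE -Rintegral_itv_obnd_cbnd; last exact: igL.
  rewrite itgB; [|exact: ighat|exact: igL].
  by field; rewrite gt_eqF.
(* The equation was derived for seeds below 1; the seed 1 is a null set. *)
have n1 : {ae mu, forall x : R, x <> 1}.
  exists [set 1]; split => //; first exact: lebesgue_measure_set1.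
  by move=> x /= /contrapT.
apply: (@filterS2 _ _ (ae_filter_ringOfSetsType mu) _ _ _ _ (volterra_ae0 dint Hat) n1).
move=> x fx x1 /andP[x0]; rewrite le_eqVlt => /predU1P[//|xlt1].
by apply/eqP; rewrite -subr_eq0; apply/eqP/fx; rewrite x0.
Qed.
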